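(* Let $q$ be a power of a prime number, $A=\mathbb{F}_q[T]$, and let $\mathfrak{p}=(p(T))$ be a nonzero prime ideal of $A$ with $p(T)$ monic irreducible of degree $d$ and $p(T)\ne T$. Let $\alpha$ be a root of $p(T)$, $\mathbb{F}_{\mathfrak{p}}=A/\mathfrak{p}=\mathbb{F}_q(\alpha)$, and let $\phi$ be the rank-$2$ Drinfeld module, over an extension of $\mathbb{F}_{\mathfrak{p}}$, defined by $\phi_T=\alpha+(\alpha+\lambda)\tau+\lambda\tau^2$. Write $\phi_{p(T)}=\sum_{i=d}^{2d}g_i\tau^i$, where the $g_i$ are polynomials in $\lambda$, and $H_{\mathfrak{p}}^{(d)}(\lambda):=g_d$. Then: (a) The polynomial $H_{\mathfrak{p}}^{(d)}(\lambda)$ is a divisor of $g_i$ for all $d\le i<2d$. Moreover, if $\phi$ (for a nonzero value of $\lambda$ in an extension field of $\mathbb{F}_{\mathfrak{p}}$) is supersingular at $\mathfrak{p}$, then $\phi_{p(T)}=\lambda^{(q^{2d}-1)/(q^2-1)}\tau^{2d}$. (b) $H_{\mathfrak{p}}^{(d)}(0)\neq0$ and $\deg_\lambda H_{\mathfrak{p}}^{(d)}(\lambda)=(q^d-1)/(q-1)$. (c) $H_{\mathfrak{p}}^{(d)}(\lambda)$ (as a polynomial in $\lambda$) and $H_{\mathfrak{p}}^{(d)}(-\alpha^qs(s+1)^{q-1})$ (as a polynomial in $s$) are each separable. (d) If $\lambda\in\overline{\mathbb{F}}_{\mathfrak{p}}$ satisfies $H_{\mathfrak{p}}^{(d)}(\lambda^{q+1})=0$,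 then $\lambda\in\mathbb{F}_{\mathfrak{p}}^{(2)}$. In particular, all the roots of $H_{\mathfrak{p}}^{(d)}(\lambda)$ are in $\mathbb{F}_{\mathfrak{p}}^{(2)}$.
   Context: For a field $L\supseteq\mathbb{F}_{\mathfrak{p}}$, $L\{\tau\}$ is the twisted polynomial ring in the $q$-Frobenius $\tau$ with $\tau l=l^q\tau$; a rank-$2$ Drinfeld module over $L$ is an $\mathbb{F}_q$-algebra homomorphism $\phi:A\to L\{\tau\}$, $a\mapsto\phi_a$, with $\phi_T=\alpha+A_1\tau+A_2\tau^2$, $A_2\neq0$. It is known that the coefficients of $\tau^0,\dots,\tau^{d-1}$ in $\phi_{p(T)}$ vanish. The element $\phi_a=\sum_i c_i\tau^i$ acts by $\phi_a(x)=\sum_i c_ix^{q^i}$, and $\phi$ is called supersingular at $\mathfrak{p}$ when $\{x\in\overline{L}\mid\phi_{p(T)}(x)=0\}=\{0\}$. In the statements about polynomials, $\lambda$ is an indeterminate and $\phi$ is considered over a field containing $\mathbb{F}_{\mathfrak{p}}(\lambda)$. $\overline{\mathbb{F}}_{\mathfrak{p}}$ is an algebraic closure of $\mathbb{F}_{\mathfrak{p}}$ and $\mathbb{F}_{\mathfrak{p}}^{(2)}$ the quadratic extension of $\mathbb{F}_{\mathfrak{p}}$ in it. Separable means having no multiple roots in an algebraic closure. *)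

(* Defs.v *)
From HB Require Import structures.
From mathcomp Require Import all_boot all_order all_algebra.
From mathcomp Require Import all_fingroup all_solvable all_field.

Set Implicit Arguments.
Unset Strict Implicit.
Unset Printing Implicit Defensive.

Import GRing.Theory.
Local Open Scope ring_scope.

(* The twisted polynomial ring L{tau}, where L is an extension of Fp via iota.
   A twisted polynomial \sum_i c_i tau^i is stored as the ordinary polynomial
   with the same coefficients, wrapped in a record so that it does not inherit
   the commutative product of {poly L}. *)
Record twpoly (Fq : finFieldType) (Fp : fieldExtType Fq) (L : fieldType)
  (iota : {rmorphism Fp -> L}) := TwPoly { tw_val : {poly L} }.

Section TwistedPolynomialRing.

Variables (Fq : finFieldType) (Fp : fieldExtType Fq).
Variables (L : fieldType) (iota : {rmorphism Fp -> L}).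

Local Notation q := #|Fq|.
Local Notation TwPoly := (@TwPoly Fq Fp L iota).

HB.instance Definition _ := [isNew for @tw_val Fq Fp L iota].
HB.instance Definition _ := [Choice of twpoly iota by <:].

Implicit Types (f g h : twpoly iota) (x y : L) (c : Fq).

Definition tw_coef f i : L := (tw_val f)`_i.

Lemma twpolyP f g : (forall i, tw_coef f i = tw_coef g i) <-> f = g.
Proof.
by split=> [eq_fg | -> //]; apply: val_inj; apply/polyP => i; apply: eq_fg.
Qed.

Definition tw_zero : twpoly iota := TwPoly 0.
Definition tw_opp f : twpoly iota := TwPoly (- tw_val f).
Definition tw_add f g : twpoly iota := TwPoly (tw_val f + tw_val g).

Fact tw_addA : associative tw_add.
Proof. by move=> f g h; apply: val_inj; rewrite /= addrA. Qed.
Fact tw_addC : commutative tw_add.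
Proof. by move=> f g; apply: val_inj; rewrite /= addrC. Qed.
Fact tw_add0 : left_id tw_zero tw_add.
Proof. by move=> f; apply: val_inj; rewrite /= add0r. Qed.
Fact tw_addN : left_inverse tw_zero tw_opp tw_add.
Proof. by move=> f; apply: val_inj; rewrite /= addNr. Qed.

HB.instance Definition _ :=
  GRing.isZmodule.Build (twpoly iota) tw_addA tw_addC tw_add0 tw_addN.

Lemma tw_coefD f g i : tw_coef (f + g) i = tw_coef f i + tw_coef g i.
Proof. exact: coefD. Qed.

Fact tw_frobD i x y : (x + y) ^+ (q ^ i) = x ^+ (q ^ i) + y ^+ (q ^ i).
Proof.
have [p p_pr pcharFq] := finPcharP Fq.
have pcharL : p \in [pchar L].
  by apply: (rmorph_pchar iota); apply: (rmorph_pchar (in_alg Fp)).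
have q_pnat : p.-nat q.
  by rewrite -cardsT; apply: (abelem_pgroup (fin_ring_pchar_abelem pcharFq)).
by rewrite exprDn_pchar // pnatX (eq_pnat _ (pcharf_eq pcharL)) q_pnat.
Qed.

Fact q_exp_gt0 i : (0 < q ^ i)%N.
Proof. by rewrite expn_gt0 (leq_trans _ (finNzRing_gt1 Fq)). Qed.

Fact tw_frob0 i : 0 ^+ (q ^ i) = 0 :> L.
Proof. by rewrite expr0n gtn_eqF ?q_exp_gt0. Qed.

Fact tw_frob_sum i n (F : 'I_n -> L) :
  (\sum_j F j) ^+ (q ^ i) = \sum_j F j ^+ (q ^ i).
Proof.
exact: (big_morph (fun x => x ^+ (q ^ i)) (tw_frobD i) (tw_frob0 i)).
Qed.

Fact tw_frob_scalar i c : iota c%:A ^+ (q ^ i) = iota c%:A.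
Proof.
elim: i => [|i IHi]; first by rewrite expn0 expr1.
by rewrite expnSr exprM IHi -!rmorphXn /= -in_algE -rmorphXn /= expf_card.
Qed.

(* Since tau^i * l = l^(q^i) * tau^i in L{tau}, the coefficient of tau^k in
   (\sum_i a_i tau^i) * (\sum_j b_j tau^j) is
   \sum_(i <= k) a_i * b_(k - i)^(q^i). *)
Definition tw_mul f g : twpoly iota :=
  TwPoly (\poly_(k < (size (tw_val f) + size (tw_val g)).-1)
            \sum_(i < k.+1) tw_coef f i * tw_coef g (k - i) ^+ (q ^ i)).

Definition tw_one : twpoly iota := TwPoly 1.

Fact tw_coef_mul f g k :
  tw_coef (tw_mul f g) k
    = \sum_(i < k.+1) tw_coef f i * tw_coef g (k - i) ^+ (q ^ i).
Proof.
rewrite {1}/tw_coef coef_poly ltn_predRL; case: leqP => // le_fg_k1.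
rewrite big1 // => j _; rewrite /tw_coef.
have [lf_j|lt_j_f] := leqP (size (tw_val f)) j.
  by rewrite nth_default ?mul0r.
rewrite [(tw_val g)`__]nth_default ?tw_frob0 ?mulr0 // leq_subRL -ltnS //.
by rewrite (leq_trans _ le_fg_k1) // ltn_add2r.
Qed.

Fact tw_mulA : associative tw_mul.
Proof.
move=> f g h; apply/twpolyP => k; rewrite !tw_coef_mul.
pose F j i := tw_coef f i * tw_coef g (j - i) ^+ (q ^ i)
                * tw_coef h (k - j) ^+ (q ^ j).
transitivity (\sum_(i < k.+1) \sum_(j < k.+1 | (i <= j)%N) F j i); last first.
  rewrite (exchange_big_dep predT) //=; apply: eq_bigr => j _.
  rewrite tw_coef_mul big_distrl /=.
  by rewrite (big_ord_widen k.+1 (F j) (ltn_ord j)).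
apply: eq_bigr => i _; rewrite tw_coef_mul tw_frob_sum big_distrr /=.
transitivity (\sum_(i <= j < k.+1) F j i); last by rewrite big_geq_mkord.
rewrite -[X in index_iota X _]add0n big_addn subSn ?leq_ord // big_mkord.
apply: eq_bigr => j _; rewrite /F addnK exprMn -exprM mulrA -expnD.
by rewrite -subnDA [(i + j)%N]addnC.
Qed.

Fact tw_mul1l : left_id tw_one tw_mul.
Proof.
move=> f; apply/twpolyP => k; rewrite tw_coef_mul big_ord_recl subn0.
rewrite {1}/tw_coef coef1 mul1r expn0 expr1 big1 ?addr0 // => i _.
by rewrite {1}/tw_coef coef1 mul0r.
Qed.

Fact tw_mul1r : right_id tw_one tw_mul.
Proof.
move=> f; apply/twpolyP => k; rewrite tw_coef_mul big_ord_recr /= subnn.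
rewrite [tw_coef tw_one 0]coef1 expr1n mulr1 big1 ?add0r // => i _.
by rewrite [tw_coef tw_one _]coef1 subn_eq0 leqNgt ltn_ord tw_frob0 mulr0.
Qed.

Fact tw_mulDl : left_distributive tw_mul +%R.
Proof.
move=> f g h; apply/twpolyP => k; rewrite tw_coefD !tw_coef_mul -big_split.
by apply: eq_bigr => i _; rewrite tw_coefD mulrDl.
Qed.

Fact tw_mulDr : right_distributive tw_mul +%R.
Proof.
move=> f g h; apply/twpolyP => k; rewrite tw_coefD !tw_coef_mul -big_split.
by apply: eq_bigr => i _; rewrite tw_coefD tw_frobD mulrDr.
Qed.

Fact tw_one_neq0 : tw_one != 0.
Proof. by apply/eqP => /(congr1 (@tw_val _ _ _ _))/eqP; apply/negP/oner_neq0. Qed.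

HB.instance Definition _ := GRing.Zmodule_isNzRing.Build (twpoly iota)
  tw_mulA tw_mul1l tw_mul1r tw_mulDl tw_mulDr tw_one_neq0.

Definition tw_scale c f : twpoly iota := TwPoly (iota c%:A *: tw_val f).

Fact tw_coef_scale c f k : tw_coef (tw_scale c f) k = iota c%:A * tw_coef f k.
Proof. exact: coefZ. Qed.

Fact tw_scaleA c1 c2 f : tw_scale c1 (tw_scale c2 f) = tw_scale (c1 * c2) f.
Proof.
by apply: val_inj; rewrite /= scalerA -rmorphM -!in_algE -rmorphM.
Qed.
Fact tw_scale1 : left_id 1 tw_scale.
Proof. by move=> f; apply: val_inj; rewrite /= scale1r rmorph1 scale1r. Qed.
Fact tw_scaleDr : right_distributive tw_scale +%R.
Proof. by move=> c f g; apply: val_inj; rewrite /= scalerDr. Qed.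
Fact tw_scaleDl f : {morph tw_scale^~ f : c1 c2 / c1 + c2}.
Proof. by move=> c1 c2; apply: val_inj; rewrite /= !(scalerDl, rmorphD). Qed.

HB.instance Definition _ := GRing.Zmodule_isLmodule.Build Fq (twpoly iota)
  tw_scaleA tw_scale1 tw_scaleDr tw_scaleDl.

Fact tw_scaleAl c f g : c *: (f * g) = (c *: f) * g.
Proof.
apply/twpolyP => k; rewrite tw_coef_scale !tw_coef_mul big_distrr /=.
by apply: eq_bigr => i _; rewrite tw_coef_scale mulrA.
Qed.

HB.instance Definition _ :=
  GRing.Lmodule_isLalgebra.Build Fq (twpoly iota) tw_scaleAl.

Fact tw_scaleAr c f g : c *: (f * g) = f * (c *: g).
Proof.
apply/twpolyP => k; rewrite tw_coef_scale !tw_coef_mul big_distrr /=.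
apply: eq_bigr => i _; rewrite tw_coef_scale exprMn tw_frob_scalar.
by rewrite mulrCA.
Qed.

HB.instance Definition _ :=
  GRing.Lalgebra_isAlgebra.Build Fq (twpoly iota) tw_scaleAr.

Definition tw_const x : twpoly iota := TwPoly x%:P.
Definition tau : twpoly iota := TwPoly 'X.

Lemma tau_const x : tau * tw_const x = tw_const (x ^+ q) * tau.
Proof.
apply/twpolyP => -[|[|k]]; rewrite !tw_coef_mul.
- by rewrite !big_ord1 /tw_coef !coefE mul0r expn0 expr1 mulr0.
- rewrite !big_ord_recl !big_ord0 /tw_coef !coefE /= expn0 expn1 !expr1.
  by rewrite !mul0r !addr0 add0r mul1r mulr1.
rewrite !big1 // => i _; rewrite /tw_coef !coefE.
  by case: (val i) => [|m]; rewrite ?mul0r // subn0 tw_frob0 mulr0.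
by case: (val i) => [|[|m]]; rewrite ?mul0r // subn1 tw_frob0 mulr0.
Qed.

End TwistedPolynomialRing.

Arguments tau {Fq Fp L} iota.
Arguments tw_const {Fq Fp L} iota x.

Section DrinfeldModules.

Variables (Fq : finFieldType) (Fp : fieldExtType Fq).
Variables (L : fieldType) (iota : {rmorphism Fp -> L}).

Local Notation q := #|Fq|.

(* phi is the rank-2 Drinfeld module over L with
   phi_T = iota alpha + A1 tau + A2 tau^2. *)
Definition rank2_drinfeld (phi : {lrmorphism {poly Fq} -> twpoly iota})
    (alpha : Fp) (A1 A2 : L) : Prop :=
  A2 != 0 /\
  phi 'X = tw_const iota (iota alpha) + tw_const iota A1 * tau iota
             + tw_const iota A2 * tau iota ^+ 2.

Lemma rank2_drinfeld_ex (alpha : Fp) (A1 A2 : L) :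
  A2 != 0 -> exists phi, rank2_drinfeld phi alpha A1 A2.
Proof.
move=> A2_neq0; pose phiT := tw_const iota (iota alpha)
  + tw_const iota A1 * tau iota + tw_const iota A2 * tau iota ^+ 2.
have [psi psiZ psiX] : exists2 psi : {rmorphism {poly Fq} -> twpoly iota},
    scalable psi & psi 'X = phiT.
  exists (horner_alg phiT); last exact: horner_algX.
  by move=> c f /=; rewrite linearZ /= mulr_algl.
pose psi_scalable :=
  GRing.isScalable.Build Fq {poly Fq} (twpoly iota) *:%R psi psiZ.
pose phi : {lrmorphism {poly Fq} -> twpoly iota} :=
  HB.pack (GRing.RMorphism.sort psi) psi_scalable.
by exists phi; split.
Qed.

(* The action of a twisted polynomial over L on an extension K of L. *)
Definition tw_act (K : fieldType) (j : {rmorphism L -> K})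
    (f : twpoly iota) (x : K) : K :=
  \sum_(i < size (tw_val f)) j (tw_coef f i) * x ^+ (q ^ i).

(* Supersingularity at the prime (p), where Lbar is an algebraic closure of L
   via j. *)
Definition supersingular (phi : {lrmorphism {poly Fq} -> twpoly iota})
    (p : {poly Fq}) (Lbar : closedFieldType) (j : {rmorphism L -> Lbar}) :
    Prop :=
  forall x : Lbar, tw_act j (phi p) x = 0 <-> x = 0.

End DrinfeldModules.

Definition algebraic_closure (F : fieldType) (K : closedFieldType)
    (j : {rmorphism F -> K}) : Prop :=
  forall x : K, algebraicOver j x.

Definition no_multiple_root (K : closedFieldType) (f : {poly K}) : Prop :=
  forall x : K, ~~ (('X - x%:P) ^+ 2 %| f).

(* Main.v *)
(** Comparing the coefficients of [tau^i] in [phi_T * phi_p = phi_p * phi_T]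
    shows that [(alpha^(q^i) - alpha) g_i] lies in the ideal generated by
    [g_(i-1)] and [g_(i-2)].  As [alpha^(q^i) <> alpha] unless [d] divides [i],
    this gives [g_i = 0] for [i < d] and [H | g_i] for [d <= i < 2d].

    Differentiating the same relations with respect to [lambda] kills the
    derivatives of the q-powers; at a multiple root of [H] all [g_i] and [g_i']
    with [i < 2d] would vanish, and the relation at [i = 2d+1] together with
    its derivative would then force [alpha * g_(2d)^q = 0], whereas [g_(2d)] is
    a power of [lambda].

    Finally [phi_T = (lambda tau + alpha)(tau + 1)], so the alternating sum of
    the coefficients of [phi_p] is [p(0)]; at a supersingular [lambda] this says
    [g_(2d)(lambda) = p(0)], an element of F_q, whence
    [mu^(q^(2d) - 1) = 1] if [lambda = mu^(q+1)]. *)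

Require Import Defs.
From HB Require Import structures.
From mathcomp Require Import all_boot all_order all_algebra.
From mathcomp Require Import all_fingroup all_solvable all_field.
Set Implicit Arguments.
Unset Strict Implicit.
Unset Printing Implicit Defensive.

Import GRing.Theory.
Local Open Scope ring_scope.

(** * Finite extensions of F_q and their Frobenius maps *)

Lemma dim_simple_ext (F : fieldType) (K : fieldExtType F) (p : {poly F})
    (a : K) :
  irreducible_poly p -> root (map_poly (in_alg K) p) a ->
  <<1%VS; a>>%VS = fullv -> \dim {:K} = (size p).-1.
Proof.
move=> irr_p pa0 genK; pose m := minPoly 1 a.
have p_over : map_poly (in_alg K) p \is a polyOver 1%VS.
  by apply/polyOver1P; exists p.
have [r Dm] : exists r, m = map_poly (in_alg K) r.
  exact/polyOver1P/minPolyOver.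
(* The minimal polynomial divides [p] and has coefficients in [F], so irreducibility makes the two
   associate. *)
have := minPoly_dvdp p_over pa0; rewrite -/m Dm dvdp_map => r_p.
have size_r : size r = (adjoin_degree 1 a).+1.
  by rewrite -size_minPoly -/m Dm size_map_poly.
have r1 : size r != 1%N by rewrite size_r eqSS -lt0n.
have /eqp_size size_rp := irr_p.2 r r1 r_p.
by rewrite -genK dim_Fadjoin dimv1 muln1 -size_rp size_r.
Qed.

Lemma frobenius_fixed (Fq : finFieldType) (K : fieldExtType Fq) (x : K) :
  x ^+ (#|Fq| ^ \dim {:K}) = x.
Proof. by apply/eqP; rewrite -(Fermat's_little_theorem (aspacef K)) memvf. Qed.

Lemma card_finFieldExt (Fq : finFieldType) (K : fieldExtType Fq) :
  #|FinFieldExtType K| = (#|Fq| ^ \dim {:K})%N.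
Proof.
by rewrite -(card_vspacef (Vector.class (finvect_type K))) card_vspace.
Qed.

(** If the generator were fixed, so would be every polynomial in it over [Fq], and [X^(q^j) - X]
    would have more roots than its degree. *)
Lemma frobenius_moves_generator (Fq : finFieldType) (K : fieldExtType Fq)
    (a : K) j :
  <<1%VS; a>>%VS = {:K}%VS -> (0 < j < \dim {:K})%N -> a ^+ (#|Fq| ^ j) != a.
Proof.
move=> genK /andP[j_gt0 j_lt]; apply/eqP => aj.
have q_gt1 := finNzRing_gt1 Fq.
pose KK := FinFieldExtType K.
pose f : {poly KK} := 'X^(#|Fq| ^ j) - 'X.
have size_f : size f = (#|Fq| ^ j).+1.
  rewrite size_polyDl size_polyXn // size_polyN size_polyX ltnS.
  by rewrite -[X in (X < _)%N](expn0 #|Fq|) ltn_exp2l.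
have fix_all (x : K) : x ^+ (#|Fq| ^ j) = x.
  have /Fadjoin_polyP[r /polyOver1P[s ->] ->] : x \in <<1%VS; a>>%VS.
    by rewrite genK memvf.
  rewrite horner_coef (tw_frob_sum idfun); apply: eq_bigr => i _.
  by rewrite exprMn exprAC aj coef_map (tw_frob_scalar idfun).
have : all (root f) (enum KK).
  by apply/allP=> x _; rewrite rootE !hornerE fix_all subrr.
move/max_poly_roots => /(_ _ (enum_uniq _)).
rewrite -size_poly_eq0 size_f => /(_ isT); rewrite -cardE card_finFieldExt ltnS.
by rewrite leq_exp2l // leqNgt j_lt.
Qed.

(** With [N] the cardinality of [Fp2], [X^N - X] is the product of all [X - y] for [y] in [Fp2];
    evaluated at [x], some factor must vanish. *)
Lemma fixed_in_quadratic_ext (Fq : finFieldType) (Fp : fieldExtType Fq)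
    (Fp2 : fieldExtType Fp) (C : fieldType) (i2 : {rmorphism Fp2 -> C})
    (x : C) :
  x ^+ (#|Fq| ^ (\dim {:Fp} * \dim {:Fp2})) = x -> exists y, i2 y = x.
Proof.
pose F := FinFieldExtType Fp.
pose K := FinFieldExtType (Fp2 : fieldExtType F).
have card_K : #|K| = (#|Fq| ^ (\dim {:Fp} * \dim {:Fp2}))%N.
  by rewrite expnM -card_finFieldExt; apply: card_finFieldExt.
rewrite -card_K => xK.
have /(congr1 (fun f => (map_poly i2 f).[x])) := finField_genPoly K.
rewrite rmorphB /= map_polyXn map_polyX !hornerE xK subrr.
rewrite rmorph_prod horner_prod => /esym/eqP.
rewrite prodf_seq_eq0 => /hasP[y _] /=; rewrite rmorphB /= map_polyX map_polyC.
rewrite !hornerE.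
by rewrite subr_eq0 => /eqP ->; exists y.
Qed.

(** * Coefficients of products in L{tau} *)

Section TwistedCoefficients.

Variables (Fq : finFieldType) (Fp : fieldExtType Fq).
Variables (L : fieldType) (iota : {rmorphism Fp -> L}).
Local Notation q := #|Fq|.
Implicit Types (f g : twpoly iota) (x : L).

Lemma tw_coef_sum (I : Type) (r : seq I) (P : pred I) (F : I -> twpoly iota) k :
  tw_coef (\sum_(i <- r | P i) F i) k = \sum_(i <- r | P i) tw_coef (F i) k.
Proof.
apply: (big_morph (fun f => tw_coef f k)) => [f g|].
  exact: tw_coefD.
by rewrite /tw_coef coef0.
Qed.

Lemma tw_coef_const_mul x f k :
  tw_coef (tw_const iota x * f) k = x * tw_coef f k.
Proof.
rewrite tw_coef_mul big_ord_recl subn0 expr1 big1 ?addr0 => [|i _].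
  by rewrite /tw_coef coefC.
by rewrite /tw_coef coefC mul0r.
Qed.

Lemma tw_coef_tau_mul f k :
  tw_coef (tau iota * f) k = if k is k'.+1 then tw_coef f k' ^+ q else 0.
Proof.
rewrite tw_coef_mul big_ord_recl {1}/tw_coef coefX mul0r add0r.
case: k => [|k]; first by rewrite big_ord0.
rewrite big_ord_recl {1}/tw_coef coefX mul1r subn1 expn1 big1 ?addr0 // => i _.
by rewrite {1}/tw_coef coefX mul0r.
Qed.

Lemma tw_coef_mul_const f x k :
  tw_coef (f * tw_const iota x) k = tw_coef f k * x ^+ (q ^ k).
Proof.
rewrite tw_coef_mul big_ord_recr /= subnn [tw_coef (tw_const _ _) 0]coefC.
rewrite big1 ?add0r // => i _; rewrite [tw_coef (tw_const _ _) _]coefC.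
by rewrite subn_eq0 leqNgt ltn_ord tw_frob0 // mulr0.
Qed.

(** The coefficients of [tau] are 0 and 1, both fixed by Frobenius, so right multiplication by it
    agrees with the commutative product. *)
Lemma tw_val_mul_tau f : tw_val (f * tau iota) = tw_val f * 'X.
Proof.
apply/polyP => k; rewrite coefMX.
have -> : (tw_val (f * tau iota))`_k = tw_coef (f * tau iota) k by [].
rewrite tw_coef_mul big_ord_recr /= subnn [tw_coef (tau _) 0]coefX tw_frob0 //.
rewrite mulr0 addr0.
case: k => [|k]; first by rewrite big_ord0.
rewrite big_ord_recr /= subSnn [tw_coef (tau _) 1]coefX expr1n mulr1.
rewrite big1 ?add0r // => i _; rewrite [tw_coef (tau _) _]coefX subSn 1?ltnW //.
by rewrite eqSS subn_eq0 leqNgt ltn_ord tw_frob0 // mulr0.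
Qed.

Lemma tw_coef_mul_tau f k :
  tw_coef (f * tau iota) k = if k is k'.+1 then tw_coef f k' else 0.
Proof. by rewrite /tw_coef tw_val_mul_tau coefMX; case: k. Qed.

Lemma tw_val_mul_tauX f n : tw_val (f * tau iota ^+ n) = tw_val f * 'X^n.
Proof.
elim: n => [|n IHn]; first by rewrite !expr0 !mulr1.
by rewrite !exprSr !mulrA tw_val_mul_tau IHn.
Qed.

Lemma tw_coef_monomial x n k :
  tw_coef (tw_const iota x * tau iota ^+ n) k = if k == n then x else 0.
Proof.
rewrite /tw_coef tw_val_mul_tauX /= coefCM coefXn.
by case: eqP; rewrite ?mulr1 ?mulr0.
Qed.

Section Rank2.

Variables (a0 a1 a2 : L) (phiT : twpoly iota).
Hypothesis phiTE : phiT = tw_const iota a0 + tw_const iota a1 * tau iota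
  + tw_const iota a2 * tau iota ^+ 2.

(** Multiplying by [phiT] on the left twists the coefficients of [f], on the right those of [phiT];
    equating the two yields the recursion for any [f] commuting with [phiT]. *)
Lemma tw_coef_rank2_mul f k :
  tw_coef (phiT * f) k = a0 * tw_coef f k
    + if k is k1.+1 then a1 * tw_coef f k1 ^+ q
        + if k1 is k2.+1 then a2 * tw_coef f k2 ^+ (q ^ 2) else 0
      else 0.
Proof.
rewrite phiTE !mulrDl !tw_coefD -!mulrA !tw_coef_const_mul !tw_coef_tau_mul.
case: k => [|[|k]]; rewrite ?mulr0 ?addr0 // !tw_coef_tau_mul.
  by rewrite expr0n gtn_eqF ?mulr0 ?addr0 // ltnW ?finNzRing_gt1.
by rewrite -exprM -addrA.
Qed.

Lemma tw_coef_mul_rank2 f k :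
  tw_coef (f * phiT) k = tw_coef f k * a0 ^+ (q ^ k)
    + if k is k1.+1 then tw_coef f k1 * a1 ^+ (q ^ k1)
        + if k1 is k2.+1 then tw_coef f k2 * a2 ^+ (q ^ k2) else 0
      else 0.
Proof.
rewrite phiTE expr2 !mulrDr !mulrA !tw_coefD !tw_coef_mul_tau -addrA.
by case: k => [|[|k]] /=; rewrite ?tw_coef_mul_tau !tw_coef_mul_const ?addr0.
Qed.

End Rank2.

End TwistedCoefficients.

(** * The coefficients g_i as polynomials in lambda *)

Section LegendreCoefficients.

Variables (Fq : finFieldType) (Fp : fieldExtType Fq) (alpha : Fp).
Local Notation q := #|Fq|.

(* [legendre_coef n i] is the coefficient of [tau^i] in
   [(alpha + (alpha + 'X) tau + 'X tau^2)^n]. *)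
Fixpoint legendre_coef (n i : nat) : {poly Fp} :=
  if n is n1.+1 then
    alpha%:P * legendre_coef n1 i
    + if i is i1.+1 then
        (alpha%:P + 'X) * legendre_coef n1 i1 ^+ q
        + if i1 is i2.+1 then 'X * legendre_coef n1 i2 ^+ (q ^ 2) else 0
      else 0
  else (i == 0)%:R.

(** This is g_i, obtained from the powers of phi_T by F_q-linearity. It lives over [Fp], so one
    family specializes to every field [L] and every parameter. *)
Definition drinfeld_coef (p : {poly Fq}) (i : nat) : {poly Fp} :=
  \sum_(n < size p) (p`_n)%:A *: legendre_coef n i.

Section Specialization.

Variables (L : fieldType) (iota : {rmorphism Fp -> L}) (lam : L).
Variable phi : {lrmorphism {poly Fq} -> twpoly iota}.
Hypothesis phiP : rank2_drinfeld phi alpha (iota alpha + lam) lam.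

Lemma tw_coef_phi_Xn n i :
  tw_coef (phi 'X^n) i = (map_poly iota (legendre_coef n i)).[lam].
Proof.
elim: n i => [|n IHn] i.
  rewrite expr0 rmorph1 [tw_coef 1 i]coef1 /=.
  by case: (i == 0); rewrite ?rmorph1 ?rmorph0 hornerE.
rewrite exprS rmorphM (tw_coef_rank2_mul phiP.2) /=.
case: i => [|[|i]]; rewrite !IHn !(rmorphD, rmorphM, rmorphXn, rmorph0) /=;
  by rewrite ?map_polyX ?map_polyC
    !(hornerD, hornerM, horner_exp, hornerX, hornerC).
Qed.

Lemma tw_coef_phi p i :
  tw_coef (phi p) i = (map_poly iota (drinfeld_coef p i)).[lam].
Proof.
rewrite -{1}[p]coefK poly_def linear_sum tw_coef_sum rmorph_sum horner_sum /=.
apply: eq_bigr => n _; rewrite linearZ tw_coef_scale tw_coef_phi_Xn.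
by rewrite map_polyZ hornerZ.
Qed.

End Specialization.

Lemma drinfeld_coef_comm p i :
  alpha%:P * drinfeld_coef p i
    + (if i is i1.+1 then (alpha%:P + 'X) * drinfeld_coef p i1 ^+ q
         + if i1 is i2.+1 then 'X * drinfeld_coef p i2 ^+ (q ^ 2) else 0
       else 0)
  = drinfeld_coef p i * alpha%:P ^+ (q ^ i)
    + (if i is i1.+1 then drinfeld_coef p i1 * (alpha%:P + 'X) ^+ (q ^ i1)
         + if i1 is i2.+1 then drinfeld_coef p i2 * 'X ^+ (q ^ i2) else 0
       else 0).
Proof.
(* Generic module: over the rational functions the indeterminate is a nonzero parameter and
   evaluation at it is injective, so the commutation relation descends to polynomials. *)
pose iota : {rmorphism Fp -> {fraction {poly Fp}}} := (@tofrac _ \o polyC).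
pose lam : {fraction {poly Fp}} := tofrac 'X.
have evalK f : (map_poly iota f).[lam] = tofrac f.
  by rewrite map_poly_comp /= horner_map /= -[_.['X]]/(f \Po 'X) comp_polyXr.
have lam0 : lam != 0 by rewrite tofrac_eq0 polyX_eq0.
have [phi phiP] := rank2_drinfeld_ex iota alpha (iota alpha + lam) lam0.
have /(congr1 (fun f => tw_coef f i)) : phi 'X * phi p = phi p * phi 'X.
  by rewrite -!rmorphM mulrC.
rewrite (tw_coef_rank2_mul phiP.2) (tw_coef_mul_rank2 phiP.2).
have coefE := tw_coef_phi phiP.
case: i => [|[|i]]; rewrite !(coefE, evalK, addr0) /lam /iota /=
  -!(tofracXn, tofracD, tofracM) => /eqP; rewrite tofrac_eq => /eqP -> //.
Qed.

End LegendreCoefficients.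

(** * Degrees and special values of the coefficients *)

Lemma expn_geom_mul m n : ((m ^ n - 1) %/ (m - 1) * (m - 1) = m ^ n - 1)%N.
Proof. by rewrite divnK // !subn1 predn_exp dvdn_mulr. Qed.

Lemma expn_geomS m n : (1 < m)%N ->
  ((m ^ n.+1 - 1) %/ (m - 1) = (m * ((m ^ n - 1) %/ (m - 1))).+1)%N.
Proof.
move=> m_gt1; have m1_gt0 : (0 < m - 1)%N by rewrite subn_gt0.
have geomE k : ((m ^ k - 1) %/ (m - 1) = \sum_(i < k) m ^ i)%N.
  by rewrite !subn1 predn_exp mulKn // -subn1.
rewrite !geomE big_ord_recl big_distrr /=; congr _.+1.
by apply: eq_bigr => i _; rewrite expnS.
Qed.

Lemma size_exp_bound (R : nzRingType) (f : {poly R}) k n :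
  (size f <= k.+1 -> size (f ^+ n)%R <= (k * n).+1)%N.
Proof.
move=> f_le; apply: leq_trans (size_poly_exp_leq _ _) _.
by rewrite ltnS leq_mul2r -subn1 leq_subLR add1n f_le orbT.
Qed.

Section LegendreCoefficientTheory.

Variables (Fq : finFieldType) (Fp : fieldExtType Fq) (alpha : Fp).
Local Notation q := #|Fq|.
Local Notation c := (legendre_coef alpha).
Local Notation geom n := ((q ^ n - 1) %/ (q - 1))%N.

Let q_gt1 : (1 < q)%N := finNzRing_gt1 Fq.

Let expq_eq0 k : (q ^ k == 0)%N = false.
Proof. by rewrite gtn_eqF // expn_gt0 ltnW. Qed.

Let q_eq0 : (q == 0)%N = false.
Proof. by rewrite gtn_eqF // ltnW. Qed.

Lemma legendre_coef_gt n i : (2 * n < i)%N -> c n i = 0.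
Proof.
elim: n i => [|n IHn] i; first by case: i.
rewrite mulnS add2n; case: i => [|[|i]] //=; rewrite !ltnS => ltni.
rewrite (IHn i) // (IHn i.+1) ?(IHn i.+2) 1?ltnW // 1?ltnW //.
by rewrite !expr0n expq_eq0 q_eq0 !mulr0 !addr0.
Qed.

Lemma legendre_coef_top n : c n.+1 (2 * n.+1) = 'X * c n (2 * n) ^+ (q ^ 2).
Proof.
rewrite mulnS add2n /= (legendre_coef_gt (leqnSn _)).
rewrite (legendre_coef_gt (leqnn _)).
by rewrite expr0n q_eq0 !mulr0 !add0r.
Qed.

(** Only the term ['X tau^2] reaches tau-degree [2 * n], so the exponents 1, q^2, ..., q^(2n-2) add
    up. *)
Lemma legendre_coef_topE n :
  c n (2 * n) = 'X^((q ^ (2 * n) - 1) %/ (q ^ 2 - 1)).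
Proof.
elim: n => [|n IHn]; first by rewrite muln0 subnn div0n.
rewrite legendre_coef_top IHn [in RHS]expnM expn_geomS //;
  last by rewrite (ltn_exp2l 0).
by rewrite -expnM -exprM mulnC -exprS.
Qed.

Lemma legendre_coef_0 n : c n 0 = (alpha ^+ n)%:P.
Proof. by elim: n => //= n ->; rewrite addr0 -polyCM exprS. Qed.

(** At lambda = 0, phi_T becomes alpha + alpha tau, whose n-th power has tau-degree at most n. *)
Lemma legendre_coef_horner0_gt n i : (n < i)%N -> (c n i).[0] = 0.
Proof.
elim: n i => [|n IHn] [|i] //=; first by rewrite hornerC.
rewrite ltnS => ltni; rewrite hornerD hornerM IHn 1?ltnW // mulr0 add0r.
rewrite hornerD hornerM horner_exp IHn // expr0n q_eq0.
by case: i ltni => [|i] _; rewrite mulr0 add0r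
  ?hornerM ?hornerX ?mul0r ?horner0.
Qed.

Lemma legendre_coef_horner0 n : alpha != 0 -> (c n n).[0] != 0.
Proof.
move=> alpha0; elim: n => [|n IHn] /=; first by rewrite hornerC oner_eq0.
rewrite hornerD hornerM legendre_coef_horner0_gt // mulr0 add0r hornerD.
have -> : (if n is i2.+1 then 'X * c n i2 ^+ (q ^ 2) else 0).[0] = 0.
  by case: (n) => [|m]; rewrite ?hornerM ?hornerX ?mul0r ?horner0.
by rewrite addr0 hornerM horner_exp !hornerE mulf_neq0 // expf_neq0.
Qed.

(** The degree is at most [1 + q^2 * geom i], while [geom i.+2 = 1 + q + q^2 * geom i]: the tau^2
    term never reaches the extremal degree. *)
Lemma size_legendre_coef_tail n i :
  (size (c n i) <= (geom i).+1)%N ->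
  (size ('X * c n i ^+ (q ^ 2))%R <= geom i.+2)%N.
Proof.
move=> le_c; apply: leq_trans (size_polyMleq _ _) _; rewrite size_polyX /=.
rewrite !expn_geomS // ltnS; apply: leq_trans (size_exp_bound (q ^ 2) le_c) _.
by rewrite mulnS mulnA mulnC -add1n leq_add2r ltnW.
Qed.

Lemma size_legendre_coef n i : (size (c n i) <= (geom i).+1)%N.
Proof.
elim: n i => [|n IHn] i /=; first by case: i => *;
  rewrite ?size_poly1 ?size_poly0.
apply: leq_trans (size_polyD _ _) _; rewrite geq_max mul_polyC.
rewrite (leq_trans (size_scale_leq _ _)) //=.
case: i => [|i]; first by rewrite size_poly0.
apply: leq_trans (size_polyD _ _) _; rewrite geq_max; apply/andP; split.
  apply: leq_trans (size_polyMleq _ _) _.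
  rewrite addrC size_XaddC /= expn_geomS //.
  by rewrite ltnS mulnC size_exp_bound.
case: i => [|i]; first by rewrite size_poly0.
by rewrite leqW // size_legendre_coef_tail.
Qed.

(** The bound on the degree becomes strict off the diagonal, so the powers of [T] below [d] cannot
    disturb the leading term of g_d. *)
Lemma size_legendre_coef_gt n i : (n < i)%N -> (size (c n i) <= geom i)%N.
Proof.
elim: n i => [|n IHn] [|i] //=; first by rewrite size_poly0.
rewrite ltnS => ltni.
apply: leq_trans (size_polyD _ _) _; rewrite geq_max mul_polyC.
rewrite (leq_trans (size_scale_leq _ _)) ?IHn ?leqW //=.
apply: leq_trans (size_polyD _ _) _; rewrite geq_max; apply/andP; split.
  have [k Dk] : exists k, geom i = k.+1.
    by case: i ltni {IHn} => // i _; rewrite expn_geomS //; eexists.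
  apply: leq_trans (size_polyMleq _ _) _.
  rewrite addrC size_XaddC /= expn_geomS //.
  have := IHn i ltni; rewrite Dk ltnS => /(size_exp_bound q)/leq_trans; apply.
  by rewrite mulnS mulnC -add1n leq_add2r ltnW.
case: i ltni {IHn} => [|i] _; first by rewrite size_poly0.
by rewrite size_legendre_coef_tail ?size_legendre_coef.
Qed.

Lemma legendre_coef_diag n :
  c n n \is monic /\ size (c n n) = (geom n).+1.
Proof.
elim: n => [|n [c_monic size_c]] /=.
  by rewrite monic1 size_poly1 subnn div0n.
(* The middle term carries the leading coefficient; the other two have smaller degree. *)
set A := (alpha%:P + 'X) * c n n ^+ q.
have A_monic : A \is monic by rewrite monicMl ?monic_exp // addrC monicXaddC.
have size_A : size A = (geom n.+1).+1.
  rewrite size_monicM ?monic_exp ?expf_neq0 ?monic_neq0 //; last first.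
    by rewrite addrC monicXaddC.
  rewrite addrC size_XaddC /= expn_geomS // mulnC.
  have := size_exp (c n n) q; rewrite size_c /= => <-.
  by rewrite prednK // lt0n size_poly_eq0 expf_neq0 // monic_neq0.
set B := (X in A + X); rewrite [A + B]addrC addrA addrC.
set D := (X in A + X).
have size_D : (size D < size A)%N.
  rewrite size_A ltnS; apply: leq_trans (size_polyD _ _) _.
  rewrite geq_max mul_polyC (leq_trans (size_scale_leq _ _)) //=;
    last exact: size_legendre_coef_gt.
  rewrite /B; case: (n) => [|m]; first by rewrite size_poly0.
  by rewrite size_legendre_coef_tail ?size_legendre_coef.
by rewrite monicE lead_coefDl // size_polyDl // -monicE.
Qed.

End LegendreCoefficientTheory.

(** * Vanishing and divisibility among the g_i *)

Lemma deriv_frobenius (Fq : finFieldType) (Fp : fieldExtType Fq)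
    (f : {poly Fp}) k :
  (0 < k)%N -> (f ^+ (#|Fq| ^ k))^`() = 0.
Proof.
move=> k_gt0; have q0 : #|Fq|%:R = 0 :> Fq.
  by rewrite -cardsT -FinRing.zmodXgE expg_cardG ?inE.
rewrite deriv_exp -mulr_natr natrX -[#|Fq|%:R](rmorph_nat (polyC \o in_alg Fp)).
by rewrite q0 rmorph0 expr0n gtn_eqF // mulr0.
Qed.

Section HasseInvariant.

Variables (Fq : finFieldType) (p : {poly Fq}).
Variables (Fp : fieldExtType Fq) (alpha : Fp).
Hypotheses (p_monic : p \is monic) (p_irr : irreducible_poly p) (pX : p != 'X).
Hypothesis (p_alpha : root (map_poly (in_alg Fp) p) alpha).
Hypothesis (alpha_gen : <<1%VS; alpha>>%VS = fullv).

Local Notation q := #|Fq|.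
Local Notation d := (size p).-1.
Local Notation g := (drinfeld_coef alpha p).
Local Notation H := (g d).
Local Notation geom n := ((q ^ n - 1) %/ (q - 1))%N.

Let q_gt1 : (1 < q)%N := finNzRing_gt1 Fq.
Let q_gt0 : (0 < q)%N := ltnW q_gt1.
Let d_gt0 : (0 < d)%N.
Proof. by case: p_irr => p_gt1 _; rewrite -ltnS prednK // ltnW. Qed.

Let expq_eq0 k : (q ^ k == 0)%N = false.
Proof. by rewrite gtn_eqF // expn_gt0 q_gt0. Qed.

Let q_eq0 : (q == 0)%N = false.
Proof. by rewrite gtn_eqF. Qed.

Lemma dim_residue_field : \dim {:Fp} = d.
Proof. exact: dim_simple_ext p_irr p_alpha alpha_gen. Qed.

Lemma constant_coef_neq0 : p`_0 != 0.
Proof.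
apply: contra pX => p0; have X_p : 'X %| p.
  by rewrite -['X]subr0 -[0]/(0%:P) dvdp_XsubCl rootE horner_coef0.
by rewrite eq_sym -eqp_monic ?monicX // p_irr.2 ?size_polyX.
Qed.

Lemma alpha_neq0 : alpha != 0.
Proof.
apply: contra constant_coef_neq0 => /eqP alpha0; move: p_alpha.
by rewrite alpha0 rootE horner_coef0 coef_map /= scaler_eq0 oner_eq0 orbF.
Qed.

(** Past [d], the [q^d]-Frobenius is the identity on [Fp], which reduces [i] to [i - d]. *)
Lemma frobenius_moves_alpha i :
  (0 < i < 2 * d)%N -> i != d -> alpha ^+ (q ^ i) != alpha.
Proof.
case/andP=> i_gt0 i_lt; rewrite neq_ltn => /orP[ltid | ltdi].
  by apply: frobenius_moves_generator; rewrite ?i_gt0 ?dim_residue_field.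
rewrite -(subnKC (ltnW ltdi)) expnD exprM -{1}dim_residue_field frobenius_fixed.
apply: frobenius_moves_generator => //; rewrite dim_residue_field subn_gt0 ltdi.
by rewrite ltn_subLR ?(ltnW ltdi) // addnn -mul2n.
Qed.

(** Monicity isolates [T^d]. The lower powers contribute nothing to the top coefficient or to the
    value of H at 0, and only lower degree terms to H. *)
Lemma drinfeld_coef_recr i :
  g i = legendre_coef alpha d i
    + \sum_(n < d) (p`_n)%:A *: legendre_coef alpha n i.
Proof.
have Dp : size p = d.+1 by rewrite prednK // ltnW // p_irr.1.
rewrite /drinfeld_coef Dp big_ord_recr /= addrC; congr (_ + _).
by rewrite -[p`_d]/(lead_coef p) (monicP p_monic) !scale1r.
Qed.

Lemma drinfeld_coef_gt i : (2 * d < i)%N -> g i = 0.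
Proof.
move=> lti; rewrite drinfeld_coef_recr legendre_coef_gt // add0r big1 // => n _.
by rewrite legendre_coef_gt ?scaler0 // (leq_ltn_trans _ lti) // leq_mul2l ltnW.
Qed.

Lemma drinfeld_coef_top : g (2 * d) = legendre_coef alpha d (2 * d).
Proof.
rewrite drinfeld_coef_recr big1 ?addr0 // => n _.
by rewrite legendre_coef_gt ?scaler0 // ltn_mul2l /=.
Qed.

(** The constant coefficient of phi_p is p(alpha). *)
Lemma drinfeld_coef_0 : g 0 = 0.
Proof.
transitivity ((map_poly (in_alg Fp) p).[alpha])%:P;
  last by rewrite (rootP p_alpha).
rewrite horner_coef size_map_poly rmorph_sum; apply: eq_bigr => n _ /=.
by rewrite legendre_coef_0 coef_map /= -mul_polyC -polyCM.
Qed.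

(** One induction step with two uses: [f = 0] gives the vanishing below [d], and [f = H] the
    divisibility above it. *)
Lemma drinfeld_coef_dvd (f : {poly Fp}) i :
    (0 < i < 2 * d)%N -> i != d ->
    (forall k, (k < i)%N -> f %| g k) ->
  f %| g i.
Proof.
move=> i_bound i_d f_lt; have i_gt0 : (0 < i)%N by case/andP: i_bound.
have fX k n u : (k < i)%N -> (0 < n)%N -> f %| u * g k ^+ n.
  by move=> lt_ki n_gt0; rewrite dvdp_mull // dvdp_exp // f_lt.
have nz : alpha ^+ (q ^ i) - alpha != 0.
  by rewrite subr_eq0 frobenius_moves_alpha.
rewrite -(dvdpZr _ _ nz) scalerBl -!mul_polyC rmorphXn /= mulrC.
have := drinfeld_coef_comm alpha p i; set A := (X in _ + X = _).
set B := (X in _ = _ + X) => comm.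
have -> : g i * alpha%:P ^+ (q ^ i) - alpha%:P * g i = A - B.
  by rewrite -[A](addKr (alpha%:P * g i)) comm -addrA addrK addrC.
rewrite /A /B; case: (i) i_gt0 fX f_lt => // -[|i1] _ fX f_lt.
  by rewrite !addr0 dvdp_sub ?fX // dvdp_mulr ?f_lt.
by rewrite dvdp_sub // dvdp_add ?fX ?expn_gt0 ?q_gt0 // dvdp_mulr ?f_lt.
Qed.

Lemma drinfeld_coef_lt i : (i < d)%N -> g i = 0.
Proof.
elim/ltn_ind: i => [[|i]] IHi lt_id; first exact: drinfeld_coef_0.
apply/eqP; rewrite -dvd0p; apply: drinfeld_coef_dvd => [||k lt_ki].
- by rewrite /= (leq_trans lt_id) // leq_pmull.
- by rewrite ltn_eqF.
by rewrite IHi // (ltn_trans lt_ki).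
Qed.

Lemma hasse_dvd i : (i < 2 * d)%N -> H %| g i.
Proof.
elim/ltn_ind: i => i IHi lt_i2d; have [-> // | i_d] := eqVneq i d.
have [-> | i_gt0] := posnP i; first by rewrite drinfeld_coef_0 dvdp0.
apply: drinfeld_coef_dvd => [||k lt_ki]; rewrite ?i_gt0 //.
by rewrite IHi // (ltn_trans lt_ki).
Qed.

Lemma hasse_horner0 : H.[0] != 0.
Proof.
rewrite drinfeld_coef_recr hornerD horner_sum big1 => [|n _].
  by rewrite addr0 legendre_coef_horner0 ?alpha_neq0.
by rewrite hornerZ legendre_coef_horner0_gt ?mulr0.
Qed.

Lemma size_hasse : (size H).-1 = geom d.
Proof.
have [_ size_c] := legendre_coef_diag alpha d.
rewrite drinfeld_coef_recr size_polyDl ?size_c // ltnS.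
apply: leq_trans (size_sum _ _ _) _; apply/bigmax_leqP => n _.
by apply: leq_trans (size_scale_leq _ _) _; apply: size_legendre_coef_gt.
Qed.

(** * Behaviour at a root of H *)

Section Evaluation.

Variables (C : fieldType) (j : {rmorphism Fp -> C}) (x : C).
Local Notation ev f := (map_poly j f).[x].
Hypothesis Hx : ev H = 0.

Lemma hasse_root_neq0 : x != 0.
Proof.
apply: contraNneq hasse_horner0 => x0; apply/eqP/(fmorph_inj j).
by rewrite -horner_map rmorph0; move: Hx; rewrite x0.
Qed.

Lemma hasse_root_coef i : (i < 2 * d)%N -> ev (g i) = 0.
Proof.
move=> lti; have /dvdpP[u ->] := hasse_dvd lti.
by rewrite rmorphM hornerM Hx mulr0.
Qed.

Lemma hasse_root_top :
  ev (g (2 * d)) = x ^+ ((q ^ (2 * d) - 1) %/ (q ^ 2 - 1)).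
Proof.
by rewrite drinfeld_coef_top legendre_coef_topE map_polyXn hornerXn.
Qed.

Lemma hasse_root_simple : ev (H^`()) != 0.
Proof.
apply/eqP => Hx'.
(* Starting at index 3 keeps every Frobenius exponent positive, so that the derivatives of all these
   powers vanish. *)
have comm i :
  j alpha * ev (g i.+3)^`() + ev (g i.+2) ^+ q + ev (g i.+1) ^+ (q ^ 2)
  = ev (g i.+3)^`() * j alpha ^+ (q ^ i.+3)
    + ev (g i.+2)^`() * (j alpha + x) ^+ (q ^ i.+2)
    + ev (g i.+1)^`() * x ^+ (q ^ i.+1).
  have /(congr1 (fun f => ev f^`())) := drinfeld_coef_comm alpha p i.+3.
  have deriv_q (f : {poly Fp}) : (f ^+ q)^`() = 0.
    by rewrite -[X in _ ^+ X]expn1 deriv_frobenius.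
  rewrite !(derivD, derivM, deriv_frobenius, deriv_q, derivX, derivC) //.
  rewrite !(mulr0, mul0r, addr0, add0r, mul1r) !(rmorphD, rmorphM, rmorphXn) /=.
  rewrite map_polyX map_polyC !(hornerD, hornerM, horner_exp, hornerX, hornerC).
  by rewrite !addrA.
have h_lt i : (i < 2 * d)%N -> ev (g i)^`() = 0.
  elim/ltn_ind: i => i IHi lt_i2d.
  have [lt_id | ] := ltnP i d.
    by rewrite drinfeld_coef_lt // deriv0 rmorph0 horner0.
  rewrite leq_eqVlt => /predU1P[<- // | lt_di].
  (* [d < i < 2 * d] excludes [d = 1], so [i] is at least 3. *)
  have [k Dk] : exists k, i = k.+3.
    exists (i - 3)%N; rewrite -addn3 subnK //.
    by move: lt_di lt_i2d d_gt0; case: (d) => [|[|n]] //;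
      case: (i) => [|[|[|]]].
  rewrite {}Dk in IHi lt_i2d lt_di *.
  have e2 := ltnW lt_i2d; have e1 := ltnW e2.
  have := comm k; rewrite (hasse_root_coef e2) (hasse_root_coef e1).
  rewrite (IHi _ _ e2) // (IHi _ _ e1) // !expr0n expq_eq0 q_eq0 !mul0r !addr0.
  move/eqP; rewrite mulrC -subr_eq0 -mulrBr mulf_eq0 => /orP[/eqP-> //|].
  rewrite subr_eq0 -rmorphXn (inj_eq (fmorph_inj j)) eq_sym => /idPn[].
  by rewrite frobenius_moves_alpha ?gtn_eqF.
have [n Dn] : exists n, d = n.+1 by exists d.-1; rewrite prednK.
have [k Dk] : exists k, (2 * d = k.+2)%N by exists (2 * n)%N; rewrite Dn mulnS.
have ltk : (k.+1 < 2 * d)%N by rewrite Dk.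
have g3 : g k.+3 = 0 by apply: drinfeld_coef_gt; rewrite Dk.
have top_neq0 : ev (g k.+2) != 0.
  by rewrite -Dk hasse_root_top expf_neq0 ?hasse_root_neq0.
(* [g (2 * d)] is ['X] times a [q^2]-th power. *)
have x_deriv : ev (g k.+2) = x * ev (g k.+2)^`().
  rewrite -Dk drinfeld_coef_top Dn legendre_coef_top derivM derivX.
  rewrite deriv_frobenius // mulr0 addr0 mul1r.
  by rewrite rmorphM /= map_polyX hornerM hornerX.
(* At index [2 * d + 1], with [G] the value of [g (2 * d)] and [G'] that of its derivative, this
   reads [G^q = G' (alpha + x)^(q^(2d))]. *)
have := comm k; rewrite g3 deriv0 rmorph0 horner0 mulr0 mul0r !add0r.
rewrite (hasse_root_coef ltk) (h_lt _ ltk) expr0n expq_eq0 mul0r !addr0.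
move=> top_deriv.
have /(congr1 (fun f => ev f)) := drinfeld_coef_comm alpha p k.+3.
rewrite g3 !(rmorphD, rmorphM, rmorphXn, rmorph0) /=.
rewrite map_polyX map_polyC !(hornerD, hornerM, horner_exp, hornerX, hornerC).
rewrite (hasse_root_coef ltk) expr0n expq_eq0 !(mulr0, mul0r, add0r, addr0).
(* The undifferentiated relation now becomes [(alpha + x) G^q = x G^q]. *)
rewrite [in RHS]x_deriv -mulrA -top_deriv mulrDl => /eqP.
rewrite -subr_eq0 addrK mulf_eq0 expf_eq0 (negPf top_neq0) andbF orbF.
by rewrite fmorph_eq0 (negPf alpha_neq0).
Qed.

End Evaluation.

End HasseInvariant.

(** * The factorisation of phi_T and evaluation at -1 *)

Section LegendreForm.

Variables (Fq : finFieldType) (Fp : fieldExtType Fq) (alpha : Fp).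
Variables (L : fieldType) (iota : {rmorphism Fp -> L}) (lam : L).
Variable phi : {lrmorphism {poly Fq} -> twpoly iota}.
Hypothesis phiP : rank2_drinfeld phi alpha (iota alpha + lam) lam.

(* [phi_T = (lam tau + alpha) (tau + 1)], and right multiplication by [tau + 1]
   multiplies the underlying polynomial by ['X + 1]. *)
Lemma tw_val_phi_hornerN1 r : (tw_val (phi r)).[-1] = iota (r`_0)%:A.
Proof.
have phiT : phi 'X
    = (tw_const iota lam * tau iota + tw_const iota (iota alpha))
      * (tau iota + 1).
  rewrite phiP.2 mulrDr mulr1 mulrDl expr2 mulrA.
  have -> : tw_const iota (iota alpha + lam)
      = tw_const iota (iota alpha) + tw_const iota lam.
    by apply: val_inj; rewrite /= polyCD.
  by rewrite mulrDl addrC [tw_const iota (iota alpha) + (_ + _)]addrC !addrA.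
elim/poly_ind: r => [|r c _].
  by rewrite rmorph0 coef0 scale0r rmorph0 horner0.
have phiC : phi c%:P = c *: 1 by rewrite -alg_polyC linearZ rmorph1.
(* Modulo the left ideal generated by [tau + 1], [phi] of a polynomial is its constant term. *)
have [f ->] : exists f, phi (r * 'X + c%:P) = f * (tau iota + 1) + c *: 1.
  by rewrite rmorphD rmorphM /= phiC phiT mulrA; eexists.
rewrite coefD coefMX coefC !eqxx add0r.
have -> : tw_val (f * (tau iota + 1) + c *: 1)
    = tw_val f * ('X + 1) + (iota c%:A)%:P.
  rewrite mulrDr mulr1.
  rewrite -[LHS]/(tw_val (f * tau iota) + tw_val f + iota c%:A *: 1).
  by rewrite tw_val_mul_tau mulrDr mulr1 alg_polyC.
by rewrite !hornerE addNr mulr0 add0r.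
Qed.

End LegendreForm.

(** * Nonzero roots of twisted polynomials, and simple roots *)

Lemma tw_act_nonzero_root (Fq : finFieldType) (Fp : fieldExtType Fq)
    (L : fieldType) (iota : {rmorphism Fp -> L}) (C : closedFieldType)
    (j : {rmorphism L -> C}) (f : twpoly iota) (m n : nat) :
    (forall i, (i < m)%N -> tw_coef f i = 0) -> tw_coef f m != 0 ->
    (m < n)%N -> tw_coef f n != 0 ->
  exists2 x, x != 0 & tw_act j f x = 0.
Proof.
move=> f_lt fm_neq0 lt_mn fn_neq0; set q := #|Fq|.
have q_gt1 : (1 < q)%N := finNzRing_gt1 Fq.
have ltq i : (m < i)%N -> (q ^ m < q ^ i)%N by move=> ?; rewrite ltn_exp2l.
have size_f i : tw_coef f i != 0 -> (i < size (tw_val f))%N.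
  by apply: contraR; rewrite -leqNgt /tw_coef => /(nth_default 0)->.
(* The action is [x^(q^m) * r(x)], where [r] is not constant and has nonzero constant term, so any
   root of [r] will do. *)
pose r : {poly C} :=
  \sum_(i < size (tw_val f)) j (tw_coef f i) *: 'X^(q ^ i - q ^ m).
(* Truncated subtraction sends indices below [m] to exponent 0, but their coefficients vanish; the
   others have distinct exponents. *)
have r_coef k : (m <= k)%N -> tw_coef f k != 0 ->
    r`_(q ^ k - q ^ m) = j (tw_coef f k).
  move=> le_mk fk; rewrite coef_sum (bigD1 (Ordinal (size_f k fk))) //=.
  rewrite coefZ coefXn eqxx mulr1 big1 ?addr0 // => i i_k.
  rewrite coefZ coefXn; have [lt_im | le_mi] := ltnP i m.
    by rewrite f_lt // rmorph0 mul0r.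
  rewrite [_ == _](_ : _ = false) ?mulr0 //; apply: contraNF i_k => /eqP eq_ki.
  apply/eqP/val_inj => /=; apply/eqP; rewrite -(eqn_exp2l _ _ q_gt1) eq_sym.
  rewrite -(subnK (_ : q ^ m <= q ^ k)%N) ?leq_exp2l // eq_ki subnK //.
  by rewrite leq_exp2l.
have r_size : size r != 1%N.
  move: (fn_neq0); apply: contra => /eqP size_r.
  rewrite -(fmorph_eq0 j) -r_coef ?(ltnW lt_mn) //.
  by rewrite nth_default // size_r subn_gt0 ltq.
have [x /rootP rx] := closed_rootP _ r_size.
exists x.
  move: (fm_neq0); apply: contraNneq => x0.
  rewrite -(fmorph_eq0 j) -r_coef // subnn.
  by rewrite -horner_coef0; move: rx; rewrite x0 => ->.
transitivity (x ^+ (q ^ m) * r.[x]); last by rewrite rx mulr0.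
rewrite horner_sum big_distrr; apply: eq_bigr => i _ /=.
rewrite hornerZ hornerXn mulrCA -exprD.
have [lt_im | le_mi] := ltnP i m; first by rewrite f_lt // rmorph0 !mul0r.
by rewrite subnKC // leq_exp2l.
Qed.

Lemma no_multiple_root_deriv (C : closedFieldType) (f : {poly C}) :
  (forall x, root f x -> f^`().[x] != 0) -> no_multiple_root f.
Proof.
move=> simple x; apply/negP => /dvdpP[u Df].
have := simple x; rewrite Df expr2 mulrA rootE hornerM hornerXsubC subrr mulr0.
rewrite eqxx.
rewrite derivM derivXsubC mulr1 hornerD !hornerM hornerXsubC subrr !mulr0 addr0.
by rewrite eqxx => /(_ isT).
Qed.

(* Differentiating [('X + 1) s = c 'X ('X + 1)^q] gives
   [s + ('X + 1) s' = c ('X + 1)^q]. *)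
Lemma legendre_param_simple (Fq : finFieldType) (Fp : fieldExtType Fq)
    (C : fieldType) (j : {rmorphism Fp -> C}) (c : Fp) (x : C) :
  let s := c *: ('X * ('X + 1) ^+ (#|Fq| - 1)) in
  (map_poly j s).[x] != 0 -> (map_poly j s^`()).[x] != 0.
Proof.
set q := #|Fq|; have q_gt0 : (0 < q)%N by apply/ltnW/finNzRing_gt1.
have X1 : ('X + 1).[x] = x + 1 by rewrite !hornerE.
move=> s; have sE : (map_poly j s).[x] = j c * (x + 1) ^+ (q - 1) * x.
  rewrite map_polyZ rmorphM rmorphXn rmorphD rmorph1 /= map_polyX.
  by rewrite hornerZ hornerM hornerX horner_exp X1 -mulrA [x * _]mulrC.
have Dq (f : {poly Fp}) : (f ^+ q)^`() = 0.
  by rewrite -[X in _ ^+ X]expn1 deriv_frobenius.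
have : ('X + 1) * s = c *: ('X * ('X + 1) ^+ q).
  by rewrite -scalerAr mulrCA -exprS subn1 prednK.
move: s sE => s sE /(congr1 (fun f => (map_poly j f^`()).[x])).
rewrite derivM derivD derivX derivC addr0 mul1r derivZ derivM derivX mul1r.
rewrite Dq mulr0 addr0 !(rmorphD, rmorphM) /= map_polyZ rmorphXn.
rewrite rmorphD rmorph1 /= map_polyX hornerD hornerM hornerZ horner_exp X1.
move=> deriv_s; apply: contraNneq => s0; move: deriv_s.
(* Both expressions for s(x) together give [c (x + 1)^(q-1) (x - (x + 1)) = 0], which forces s(x) =
   0. *)
rewrite s0 mulr0 addr0 sE -{2}(subnK q_gt0) exprD expr1 mulrA => /eqP.
rewrite -subr_eq0 -mulrBr opprD addNKr mulrN1 oppr_eq0 => /eqP->.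
by rewrite mul0r.
Qed.

(** * Assembly of claims (a) to (d) *)

Unset Implicit Arguments.

Theorem proposition3p1
  (Fq : finFieldType) (p : {poly Fq})
  (Fp : fieldExtType Fq) (alpha : Fp)
  (Fpbar : closedFieldType) (ibar : {rmorphism Fp -> Fpbar})
  (Fp2 : fieldExtType Fp) (i2 : {rmorphism Fp2 -> Fpbar}) :
  p \is monic -> irreducible_poly p -> p != 'X ->
  root (map_poly (in_alg Fp) p) alpha ->
  <<1%VS; alpha>>%VS = fullv ->
  algebraic_closure ibar ->
  \dim {:Fp2} = 2%N -> (forall c : Fp, i2 c%:A = ibar c) ->
  let q := #|Fq| in
  let d := (size p).-1 in
  exists g : nat -> {poly Fp},
    (forall (L : fieldType) (iota : {rmorphism Fp -> L}) (lam : L)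
            (phi : {lrmorphism {poly Fq} -> twpoly iota}),
       rank2_drinfeld phi alpha (iota alpha + lam) lam ->
       phi p = \sum_(d <= i < (2 * d).+1)
                  tw_const iota (map_poly iota (g i)).[lam] * tau iota ^+ i)
    /\
    let H := g d in
    (* (a) *)
    ((forall i : nat, (d <= i < 2 * d)%N -> H %| g i)
     /\
     (forall (L : fieldType) (iota : {rmorphism Fp -> L}) (lam : L)
             (phi : {lrmorphism {poly Fq} -> twpoly iota})
             (Lbar : closedFieldType) (j : {rmorphism L -> Lbar}),
        rank2_drinfeld phi alpha (iota alpha + lam) lam ->
        algebraic_closure j ->
        supersingular phi p j ->
        phi p = tw_const iota (lam ^+ ((q ^ (2 * d) - 1) %/ (q ^ 2 - 1))%N)
                  * tau iota ^+ (2 * d)))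
    /\
    (* (b) *)
    (H.[0] != 0 /\ (size H).-1 = ((q ^ d - 1) %/ (q - 1))%N)
    /\
    (* (c) *)
    (no_multiple_root (map_poly ibar H)
     /\
     no_multiple_root (map_poly ibar
       (H \Po (- (alpha ^+ q) *: ('X * ('X + 1) ^+ (q - 1))))))
    /\
    (* (d) *)
    ((forall lam : Fpbar,
        (map_poly ibar H).[lam ^+ q.+1] = 0 -> exists y : Fp2, i2 y = lam)
     /\
     (forall lam : Fpbar,
        root (map_poly ibar H) lam -> exists y : Fp2, i2 y = lam)).
Proof.
move=> p_monic p_irr pX p_alpha alpha_gen _ dim_Fp2 _ q d.
have q_gt1 : (1 < q)%N := finNzRing_gt1 Fq.
have d_gt0 : (0 < d)%N.
  by case: p_irr => p_gt1 _; rewrite -ltnS prednK // ltnW.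
pose g := drinfeld_coef alpha p.
have g_lt i : (i < d)%N -> g i = 0 by apply: drinfeld_coef_lt.
have g_top (L : fieldType) (iota : {rmorphism Fp -> L}) (lam : L) :
    (map_poly iota (g (2 * d)%N)).[lam]
      = lam ^+ ((q ^ (2 * d) - 1) %/ (q ^ 2 - 1)).
  exact: hasse_root_top.
(* At a root of H every coefficient of phi_p except the top one vanishes. *)
have g_root (L : fieldType) (iota : {rmorphism Fp -> L}) (lam : L)
    (phi : {lrmorphism {poly Fq} -> twpoly iota}) :
    rank2_drinfeld phi alpha (iota alpha + lam) lam ->
    (map_poly iota (g d)).[lam] = 0 ->
  phi p = tw_const iota (lam ^+ ((q ^ (2 * d) - 1) %/ (q ^ 2 - 1)))
            * tau iota ^+ (2 * d).
  move=> phiP H0; apply/twpolyP => i.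
  rewrite tw_coef_monomial (tw_coef_phi phiP).
  rewrite -/g -(g_top _ iota); have [-> // | i_2d] := eqVneq i (2 * d)%N.
  have [lt_i2d | lt_2di | /eqP] := ltngtP i (2 * d)%N;
    last by rewrite (negPf i_2d).
    exact: hasse_root_coef H0 _ _.
  by rewrite /g drinfeld_coef_gt // rmorph0 horner0.
have root_quadratic (lam : Fpbar) :
  (map_poly ibar (g d)).[lam ^+ q.+1] = 0 -> exists y : Fp2, i2 y = lam.
  set l := lam ^+ q.+1 => Hl.
  have l_neq0 : l != 0 by apply: hasse_root_neq0 Hl.
  have [phi phiP] := rank2_drinfeld_ex ibar alpha (ibar alpha + l) l_neq0.
  (* Since [(-1)^(2d) = 1], evaluation at -1 identifies [l^N] with p(0), an element of F_q. *)
  have := tw_val_phi_hornerN1 phiP p; rewrite (g_root _ _ _ _ phiP Hl).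
  rewrite tw_val_mul_tauX hornerM hornerXn exprM sqrrN !expr1n mulr1 hornerC.
  set N := (_ %/ _)%N; set c := ibar _ => lN.
  have c_neq0 : c != 0 by rewrite -lN expf_neq0.
  have cq1 : c ^+ (q - 1) = 1.
    apply: (mulIf c_neq0); rewrite -exprSr subn1 prednK ?(ltnW q_gt1) // mul1r.
    by rewrite /c -[q]expn1 tw_frob_scalar.
  apply: (@fixed_in_quadratic_ext Fq); rewrite dim_Fp2 mulnC.
  rewrite (dim_residue_field p_irr p_alpha alpha_gen) -/d -/q.
  (* As [q^2 - 1 = (q + 1)(q - 1)], this turns [lam^(q^(2d))] into [lam * (l^N)^(q-1)], that is,
     [lam]. *)
  have -> : (q ^ (2 * d) = (q.+1 * N * (q - 1)).+1)%N.
    have -> : (q.+1 * N * (q - 1) = N * (q ^ 2 - 1))%N.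
      rewrite -[X in (_ ^ 2 - X)%N](exp1n 2) subn_sqr addn1 mulnAC [RHS]mulnC.
      by rewrite [(q.+1 * _)%N]mulnC.
    by rewrite /N expnM expn_geom_mul subn1 prednK // expn_gt0 expn_gt0 ltnW.
  by rewrite exprS !exprM -/l lN cq1 mulr1.
exists g; split; [|split; [split|split; [split|split; split]]].
- move=> L iota lam phi phiP; apply/twpolyP => i.
  rewrite tw_coef_sum (tw_coef_phi phiP) -/g.
  under eq_bigr do rewrite tw_coef_monomial.
  rewrite -big_mkcond /=.
  have [i_in | i_out] := boolP (i \in index_iota d (2 * d).+1).
    rewrite (big_rem i) //= eqxx big1_seq ?addr0 // => k.
    by rewrite mem_rem_uniq ?iota_uniq // !inE => /andP[/eqP->]; rewrite eqxx.
  rewrite big1_seq => [|k /andP[/eqP <-]]; last by rewrite (negPf i_out).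
  move: i_out; rewrite mem_index_iota negb_and -ltnNge -leqNgt.
  case/orP=> [lt_id | lt_2di]; first by rewrite g_lt // rmorph0 horner0.
  by rewrite /g drinfeld_coef_gt // rmorph0 horner0.
- by move=> i /andP[_ lt_i2d]; apply: hasse_dvd.
- move=> L iota lam phi Lbar j phiP _ ss; apply: (g_root _ _ _ _ phiP).
  (* If H did not vanish at [lam], the coefficients at [d] and [2 * d] would both be nonzero and
     phi_p would have a nonzero root. *)
  apply/eqP/negPn/negP => gd_neq0.
  have [||||x x_neq0 /ss x0] :=
    @tw_act_nonzero_root _ _ _ _ _ j (phi p) d (2 * d).
  + by move=> i lt_id; rewrite (tw_coef_phi phiP) -/g g_lt // rmorph0 horner0.
  + by rewrite (tw_coef_phi phiP).
  + by rewrite mul2n -addnn -ltn_subLR // subnn.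
  + by rewrite (tw_coef_phi phiP) -/g g_top expf_neq0 // phiP.1.
  by rewrite x0 eqxx in x_neq0.
- exact: hasse_horner0.
- exact: size_hasse.
- apply: no_multiple_root_deriv => x /rootP Hx; rewrite deriv_map.
  exact: hasse_root_simple.
- apply: no_multiple_root_deriv => x; rewrite rootE deriv_map deriv_comp.
  rewrite rmorphM hornerM /= !map_comp_poly !horner_comp; set y := _.[x].
  (* Chain rule: the outer factor is nonzero as roots of H are simple, the inner one because [y] is
     nonzero, H being nonzero at 0. *)
  move=> /eqP Hy; rewrite mulf_neq0 ?hasse_root_simple //.
  apply: legendre_param_simple.
  exact: (hasse_root_neq0 p_monic p_irr pX p_alpha Hy).
- exact: root_quadratic.
move=> lam /rootP Hlam.
(* A [(q+1)]-th root [mu] of [lam] comes from [Fp2] by the preceding claim, hence so does [lam]. *)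
have size_f : size ('X^(q.+1) - lam%:P) != 1%N.
  by rewrite size_XnsubC.
have [mu] := closed_rootP _ size_f.
rewrite rootE !hornerE subr_eq0 => /eqP Dlam.
have [y Dy] : exists y : Fp2, i2 y = mu by apply: root_quadratic; rewrite Dlam.
by exists (y ^+ q.+1); rewrite rmorphXn /= Dy.
Qed.
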